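(* In the source coding problem with receiver side information described in the context, suppose $U=Y$ and $V=X$ (i.e. $U_i=Y_i$ and $V_i=X_i$ for all $i$). Then the set $\mathcal{R}$ of achievable rate triples equals the closure of $\bigcup_{p\in\mathcal{P}}\mathcal{R}_{out}^{(p)}$.
   Context: Let $\mathcal{X},\mathcal{Y},\mathcal{U},\mathcal{V}$ be finite sets and let $\{(X_i,Y_i,U_i,V_i)\}_{i\ge1}$ be i.i.d. with joint distribution $\mathcal{Q}_{XYUV}$. For $i=0,1,2$ let $\mathcal{M}_i=\{1,\dots,|\mathcal{M}_i|\}$ be finite index sets. A code of block length $n$ consists of an encoder $e^{(n)}:\mathcal{X}^n\times\mathcal{Y}^n\to\mathcal{M}_0\times\mathcal{M}_1\times\mathcal{M}_2$, $(M_0,M_1,M_2)=e^{(n)}(X^n,Y^n)$, a decoder $d_x^{(n)}:\mathcal{M}_0\times\mathcal{M}_1\times\mathcal{U}^n\to\mathcal{X}^n$, $\widehat X^n=d_x^{(n)}(M_0,M_1,U^n)$, and a decoder $d_y^{(n)}:\mathcal{M}_0\times\mathcal{M}_2\times\mathcal{V}^n\to\mathcal{Y}^n$, $\widehat Y^n=d_y^{(n)}(M_0,M_2,V^n)$. Let $P_e=\max\{\Pr[\widehat X^n\ne X^n],\Pr[\widehat Y^n\ne Y^n]\}$. A triple $(R_0,R_1,R_2)$ is achievable if for every $\epsilon>0$ and all sufficiently large $n$ there is such a code with $P_e\le\epsilon$ and $(1/n)\log_2|\mathcal{M}_i|\le R_i+\epsilon$, $i=0,1,2$; $\mathcal{R}$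 is the set of achievable triples. Let $\mathcal{W}$ be a finite set with $|\mathcal{W}|\le|\mathcal{X}||\mathcal{Y}|+3$, and let $\mathcal{P}$ be the family of probability functions $p$ on $\mathcal{W}\times\mathcal{X}\times\mathcal{Y}\times\mathcal{U}\times\mathcal{V}$ with $p(w,x,y,u,v)=p(w|x,y)p(x,y,u,v)$ and $\sum_w p(w,x,y,u,v)=\mathcal{Q}_{XYUV}(x,y,u,v)$. For $p\in\mathcal{P}$, with $J_p=\max\{I_p(X,Y;W|U),I_p(X,Y;W|V)\}$, let $\mathcal{R}_{out}^{(p)}$ be the set of $(R_0,R_1,R_2)$ with $R_0\ge J_p$, $R_0+R_1\ge J_p+H_p(X|W,U)$, $R_0+R_2\ge J_p+H_p(Y|W,V)$.
   Formalization: The rates R_0, R_1, R_2 in R_out^{(p)} are required to be nonnegative; without this the equality fails, since R_out^{(p)} contains triples with large R_0 and negative R_1, which are never achievable. *)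

(* Defs.v *)
From HB Require Import structures.
From mathcomp Require Import all_boot all_order all_algebra.
From mathcomp Require Import boolp classical_sets reals topology normedtype exp.
Set Implicit Arguments. Unset Strict Implicit. Unset Printing Implicit Defensive.
Import Order.TTheory GRing.Theory Num.Theory.
Import numFieldNormedType.Exports.
Local Open Scope ring_scope.
Local Open Scope classical_set_scope.

Definition log2 {R : realType} (x : R) : R := ln x / ln 2.

Definition is_pmf {R : realType} {T : finType} (P : {ffun T -> R}) : Prop :=
  (forall t, 0 <= P t) /\ \sum_(t : T) P t = 1.

Definition marg {R : realType} {T S : finType} (P : T -> R) (f : T -> S) (s : S) : R :=
  \sum_(t | f t == s) P t.

(** Entropy H(f) (base 2, with the convention 0 log 0 = 0). *)
Definition ent {R : realType} {T S : finType} (P : T -> R) (f : T -> S) : R :=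
  - \sum_(s : S) marg P f s * log2 (marg P f s).

Definition cent {R : realType} {T S1 S2 : finType} (P : T -> R)
  (f : T -> S1) (g : T -> S2) : R :=
  ent P (fun t => (f t, g t)) - ent P g.

Definition cmi {R : realType} {T S1 S2 S3 : finType} (P : T -> R)
  (f : T -> S1) (g : T -> S2) (h : T -> S3) : R :=
  cent P f h - cent P f (fun t => (g t, h t)).

Definition prob_iid {R : realType} {T : finType} (Q : {ffun T -> R}) (n : nat)
  (E : {ffun 'I_n -> T} -> bool) : R :=
  \sum_(s : {ffun 'I_n -> T}) (\prod_(i < n) Q (s i)) * (E s)%:R.

Section Proj.
Variables (X Y U V : finType) (n : nat).
Definition seqX (s : {ffun 'I_n -> X * Y * U * V}) : {ffun 'I_n -> X} :=
  [ffun i => (s i).1.1.1].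
Definition seqY (s : {ffun 'I_n -> X * Y * U * V}) : {ffun 'I_n -> Y} :=
  [ffun i => (s i).1.1.2].
Definition seqU (s : {ffun 'I_n -> X * Y * U * V}) : {ffun 'I_n -> U} :=
  [ffun i => (s i).1.2].
Definition seqV (s : {ffun 'I_n -> X * Y * U * V}) : {ffun 'I_n -> V} :=
  [ffun i => (s i).2].
End Proj.

Definition rate {R : realType} (n m : nat) : R := n%:R^-1 * log2 (m%:R : R).

Definition achievable {R : realType} {X Y U V : finType}
  (Q : {ffun X * Y * U * V -> R}) (r : R * R * R) : Prop :=
  forall eps : R, 0 < eps -> exists N : nat, forall n : nat, (N <= n)%N ->
  exists (m0 m1 m2 : nat)
    (e : {ffun 'I_n -> X} -> {ffun 'I_n -> Y} -> 'I_m0 * 'I_m1 * 'I_m2)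
    (dx : 'I_m0 -> 'I_m1 -> {ffun 'I_n -> U} -> {ffun 'I_n -> X})
    (dy : 'I_m0 -> 'I_m2 -> {ffun 'I_n -> V} -> {ffun 'I_n -> Y}),
    let errX := prob_iid Q (fun s =>
          let c := e (seqX s) (seqY s) in dx c.1.1 c.1.2 (seqU s) != seqX s) in
    let errY := prob_iid Q (fun s =>
          let c := e (seqX s) (seqY s) in dy c.1.1 c.2 (seqV s) != seqY s) in
    [/\ Num.max errX errY <= eps,
        rate n m0 <= r.1.1 + eps,
        rate n m1 <= r.1.2 + eps &
        rate n m2 <= r.2 + eps].

Definition achievable_region {R : realType} {X Y U V : finType}
  (Q : {ffun X * Y * U * V -> R}) : set (R * R * R) :=
  [set r | achievable Q r].

Definition is_kernel {R : realType} {X Y W : finType}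
  (k : {ffun X * Y -> {ffun W -> R}}) : Prop :=
  forall xy, is_pmf (k xy).

Definition joint {R : realType} {X Y U V W : finType}
  (Q : {ffun X * Y * U * V -> R}) (k : {ffun X * Y -> {ffun W -> R}})
  (t : W * X * Y * U * V) : R :=
  let: (w, x, y, u, v) := t in k (x, y) w * Q (x, y, u, v).

Definition rvW {W X Y U V : Type} (t : W * X * Y * U * V) : W := t.1.1.1.1.
Definition rvX {W X Y U V : Type} (t : W * X * Y * U * V) : X := t.1.1.1.2.
Definition rvY {W X Y U V : Type} (t : W * X * Y * U * V) : Y := t.1.1.2.
Definition rvU {W X Y U V : Type} (t : W * X * Y * U * V) : U := t.1.2.
Definition rvV {W X Y U V : Type} (t : W * X * Y * U * V) : V := t.2.
Definition rvXY {W X Y U V : Type} (t : W * X * Y * U * V) : X * Y :=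
  (rvX t, rvY t).
Definition rvWU {W X Y U V : Type} (t : W * X * Y * U * V) : W * U :=
  (rvW t, rvU t).
Definition rvWV {W X Y U V : Type} (t : W * X * Y * U * V) : W * V :=
  (rvW t, rvV t).

Definition Rout {R : realType} {X Y U V W : finType}
  (Q : {ffun X * Y * U * V -> R}) (k : {ffun X * Y -> {ffun W -> R}})
  : set (R * R * R) :=
  let p := joint Q k in
  let J := Num.max (cmi p rvXY rvW rvU) (cmi p rvXY rvW rvV) in
  [set r | [/\ [/\ 0 <= r.1.1, 0 <= r.1.2 & 0 <= r.2],
              J <= r.1.1,
              J + cent p rvX rvWU <= r.1.1 + r.1.2 &
              J + cent p rvY rvWV <= r.1.1 + r.2]].

(* Main.v *)
(* As U = Y, the chain rule gives I(X,Y;W|U) + H(X|W,U) = H(X|Y) for every W, and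
   symmetrically for Y, while a constant W has J = 0.  The union is therefore the closed
   set R0 + R1 >= H(X|Y), R0 + R2 >= H(Y|X), R0, R1, R2 >= 0.  Given y^n, a code
   decodes correctly at most |M0||M1| sequences x^n, each of conditional probability about
   2^(-n H(X|Y)): this is the converse.  For achievability, colour greedily the edges of
   the bipartite graph of typical pairs (x^n, y^n) by triples (m0, m1, m2) such that
   (m0, m1) is injective around each y^n and (m0, m2) around each x^n. *)
Require Import Defs.
From HB Require Import structures.
From mathcomp Require Import all_boot all_order all_algebra.
From mathcomp Require Import boolp classical_sets reals topology normedtype exp.
From mathcomp Require Import ring lra.
Set Implicit Arguments. Unset Strict Implicit. Unset Printing Implicit Defensive.
Import Order.TTheory GRing.Theory Num.Theory.
Import numFieldNormedType.Exports.
Local Open Scope ring_scope.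

(** * Logarithms, marginals, entropy and conditional probabilities *)

Lemma ln2_gt0 (R : realType) : 0 < ln 2 :> R.
Proof. by rewrite ln_gt0 // ltr1n. Qed.

Lemma log2E (R : realType) (x : R) : log2 x * ln 2 = ln x.
Proof. by rewrite /log2 divfK // gt_eqF // ln2_gt0. Qed.

Lemma marg_ge0 (R : realType) (T S : finType) (P : T -> R) (f : T -> S) s :
  (forall t, 0 <= P t) -> 0 <= marg P f s.
Proof. by move=> P0; apply: sumr_ge0. Qed.

Lemma le_marg (R : realType) (T S : finType) (P : T -> R) (f : T -> S) t :
  (forall t, 0 <= P t) -> P t <= marg P f (f t).
Proof. by move=> P0; rewrite /marg (bigD1 t) //= lerDl sumr_ge0. Qed.

Lemma sum_marg_comp (R : realType) (T S : finType) (P : T -> R) (f : T -> S)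
    (F : S -> R) :
  \sum_s marg P f s * F s = \sum_t P t * F (f t).
Proof.
rewrite (partition_big f predT) //=; apply: eq_bigr => s _.
by rewrite /marg mulr_suml; apply: eq_bigr => t /eqP->.
Qed.

Lemma entE (R : realType) (T S : finType) (P : T -> R) (f : T -> S) :
  ent P f = - \sum_t P t * log2 (marg P f (f t)).
Proof. by rewrite /ent sum_marg_comp. Qed.

(** Entropy sees a variable only through the partition it induces on the support of [P]. The
    relations U = Y and V = X, which hold only on the support, enter the entropy identities in this
    way. *)
Lemma eq_ent (R : realType) (T S1 S2 : finType) (P : T -> R)
    (f : T -> S1) (g : T -> S2) :
  (forall t t', P t != 0 -> P t' != 0 -> (f t == f t') = (g t == g t')) ->
  ent P f = ent P g.
Proof.
move=> fg; rewrite !entE; congr (- _); apply: eq_bigr => t _.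
have [->|Pt] := eqVneq (P t) 0; first by rewrite !mul0r.
congr (_ * log2 _); rewrite /marg [LHS]big_mkcond [RHS]big_mkcond /=.
apply: eq_bigr => t' _; have [->|Pt'] := eqVneq (P t') 0; first by rewrite !if_same.
by rewrite fg.
Qed.

Lemma eq_marg (R : realType) (T T' S : finType) (P : T -> R) (P' : T' -> R)
    (f : T -> S) (p : T' -> T) s :
  (forall t, marg P' p t = P t) -> marg P' (f \o p) s = marg P f s.
Proof.
move=> PE; rewrite /marg (partition_big p (fun t => f t == s)) //=.
apply: eq_bigr => t /eqP <-; rewrite -PE; apply: eq_bigl => t'.
by apply/andP/idP => [[]//|/eqP->]; rewrite !eqxx.
Qed.

Lemma ent_comp (R : realType) (T T' S : finType) (P : T -> R) (P' : T' -> R)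
    (f : T -> S) (p : T' -> T) :
  (forall t, marg P' p t = P t) -> ent P' (f \o p) = ent P f.
Proof.
by move=> PE; rewrite /ent; under eq_bigr do rewrite (eq_marg _ _ PE).
Qed.

(** The value is 0 when [b] has probability zero, since the inverse of 0 is 0; hence the sum over
    [a] is in general only at most 1. *)
Definition condp {R : realType} {T A B : finType} (P : T -> R)
    (f : T -> A) (g : T -> B) (a : A) (b : B) : R :=
  marg P (fun t => (f t, g t)) (a, b) / marg P g b.

Lemma condp_ge0 (R : realType) (T A B : finType) (P : T -> R)
    (f : T -> A) (g : T -> B) a b :
  (forall t, 0 <= P t) -> 0 <= condp P f g a b.
Proof. by move=> P0; rewrite divr_ge0 ?marg_ge0. Qed.

Lemma sum_marg_pair (R : realType) (T A B : finType) (P : T -> R)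
    (f : T -> A) (g : T -> B) b :
  \sum_a marg P (fun t => (f t, g t)) (a, b) = marg P g b.
Proof.
rewrite [RHS]/marg (partition_big f predT) //=; apply: eq_bigr => a _.
by apply: eq_bigl => t; rewrite xpair_eqE andbC.
Qed.

Lemma marg_pairE (R : realType) (T A B : finType) (P : T -> R)
    (f : T -> A) (g : T -> B) a b :
  (forall t, 0 <= P t) ->
  marg P (fun t => (f t, g t)) (a, b) = condp P f g a b * marg P g b.
Proof.
move=> P0; have [gb|gb] := eqVneq (marg P g b) 0; last by rewrite /condp divfK.
rewrite gb mulr0; apply/eqP.
have := sum_marg_pair P f g b; rewrite gb => /eqP.
rewrite psumr_eq0 => [/allP/(_ a)|a' _]; last exact: marg_ge0.
by rewrite mem_index_enum => /(_ isT).
Qed.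

Lemma sum_condp_le1 (R : realType) (T A B : finType) (P : T -> R)
    (f : T -> A) (g : T -> B) b :
  \sum_a condp P f g a b <= 1.
Proof.
rewrite -mulr_suml sum_marg_pair.
by have [->|gb] := eqVneq (marg P g b) 0; rewrite ?mul0r ?divff.
Qed.

Lemma condp_gt0 (R : realType) (T A B : finType) (P : T -> R)
    (f : T -> A) (g : T -> B) t :
  (forall t, 0 <= P t) -> P t != 0 -> 0 < condp P f g (f t) (g t).
Proof.
move=> P0 Pt; have {}Pt : 0 < P t by rewrite lt0r Pt P0.
by rewrite divr_gt0 //; apply: lt_le_trans Pt _;
  [exact: (le_marg (fun t => (f t, g t)))|exact: le_marg].
Qed.

(** The logarithm of the quotient splits on the support; off the support both sides have weight 0.
    The factor [ln 2] converts bits to nats. *)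
Lemma centE (R : realType) (T A B : finType) (P : T -> R)
    (f : T -> A) (g : T -> B) :
  (forall t, 0 <= P t) ->
  \sum_t P t * ln (condp P f g (f t) (g t)) = - (cent P f g * ln 2).
Proof.
move=> P0; set L := LHS.
suff -> : L = (\sum_t P t * log2 (marg P (fun t => (f t, g t)) (f t, g t))) * ln 2
              - (\sum_t P t * log2 (marg P g (g t))) * ln 2.
  by rewrite /cent !entE; ring.
rewrite !mulr_suml -sumrB; apply: eq_bigr => t _.
have [->|Pt] := eqVneq (P t) 0; first by rewrite !mul0r subrr.
have {}Pt : 0 < P t by rewrite lt0r Pt P0.
rewrite -[X in _ = X - _]mulrA -[X in _ = _ - X]mulrA !log2E -mulrBr ln_div //.
  by rewrite posrE; apply: lt_le_trans Pt _; exact: (le_marg (fun t => (f t, g t))).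
by rewrite posrE; apply: lt_le_trans Pt _; exact: le_marg.
Qed.

(** * I.i.d. blocks: union bound, weak law, asymptotic equipartition *)

Lemma sum_prod_iid (R : realType) (T : finType) (n : nat) (h : 'I_n -> T -> R) :
  \sum_(s : {ffun 'I_n -> T}) \prod_(i < n) h i (s i) = \prod_(i < n) \sum_t h i t.
Proof. by rewrite (bigA_distr_bigA h). Qed.

Lemma sum_iid_marg (R : realType) (T S : finType) (P : T -> R) (f : T -> S)
    (n : nat) (b : {ffun 'I_n -> S}) :
  \sum_(s : {ffun 'I_n -> T} | [forall i, f (s i) == b i]) \prod_(i < n) P (s i) =
  \prod_(i < n) marg P f (b i).
Proof.
rewrite /marg (bigA_distr_big_dep (fun i t => f t == b i) (fun _ t => P t)).
by apply: eq_bigl => s; apply/forallP/familyP.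
Qed.

Section ProbIid.
Context {R : realType} {T : finType} (Q : {ffun T -> R}).
Hypothesis Qpmf : is_pmf Q.
Implicit Types (n : nat).

Let Q0 t : 0 <= Q t. Proof. by case: Qpmf. Qed.
Let Q1 : \sum_t Q t = 1. Proof. by case: Qpmf. Qed.

(** A block containing a letter of probability zero has weight zero, so the implication matters only
    on the support. *)
Lemma prob_iid_le n (E F : {ffun 'I_n -> T} -> bool) :
  (forall s : {ffun 'I_n -> T}, (forall i, Q (s i) != 0) -> E s -> F s) ->
  prob_iid Q E <= prob_iid Q F.
Proof.
move=> EF; apply: ler_sum => s _.
have [i /eqP Qi|Qs] := pickP (fun i => Q (s i) == 0).
  by rewrite (bigD1 i) //= Qi !mul0r.
apply: ler_wpM2l; first exact: prodr_ge0.
have {}EF : E s ==> F s by apply/implyP/EF => i; rewrite Qs.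
by case: (E s) (F s) EF => [] [].
Qed.

Lemma prob_iidU n (E F : {ffun 'I_n -> T} -> bool) :
  prob_iid Q (fun s => E s || F s) <= prob_iid Q E + prob_iid Q F.
Proof.
rewrite -big_split /=; apply: ler_sum => s _; rewrite -mulrDr.
apply: ler_wpM2l; first exact: prodr_ge0.
by case: (E s) (F s) => [] []; rewrite ?addr0 ?add0r // lerDl.
Qed.

Lemma prob_iidT n : prob_iid Q (fun _ : {ffun 'I_n -> T} => true) = 1.
Proof.
rewrite /prob_iid; under eq_bigr do rewrite mulr1.
by rewrite (sum_prod_iid (fun _ t => Q t)) big1.
Qed.

Lemma expect_prod n (h : 'I_n -> T -> R) :
  \sum_(s : {ffun 'I_n -> T}) (\prod_(i < n) Q (s i)) * \prod_(i < n) h i (s i) =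
  \prod_(i < n) \sum_t Q t * h i t.
Proof.
rewrite -(sum_prod_iid (fun i t => Q t * h i t)).
by apply: eq_bigr => s _; rewrite big_split.
Qed.

(** Expanding the square, the cross terms vanish by independence and zero mean, and the [n] diagonal
    terms coincide. *)
Lemma variance_sum n (Z : T -> R) : \sum_t Q t * Z t = 0 ->
  \sum_(s : {ffun 'I_n -> T}) (\prod_(i < n) Q (s i)) * (\sum_(i < n) Z (s i)) ^+ 2 =
  n%:R * \sum_t Q t * Z t ^+ 2.
Proof.
move=> EZ; transitivity (\sum_(i < n) \sum_(j < n)
   \sum_(s : {ffun 'I_n -> T}) (\prod_(k < n) Q (s k)) * (Z (s i) * Z (s j))).
  under [RHS]eq_bigr do rewrite exchange_big /=; rewrite [RHS]exchange_big /=.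
  apply: eq_bigr => s _; rewrite expr2 mulr_suml mulr_sumr.
  by apply: eq_bigr => i _; rewrite !mulr_sumr.
rewrite -[n in RHS]card_ord -sumr_const mulr_suml; apply: eq_bigr => i _.
rewrite mul1r (bigD1 i) //= [X in _ + X]big1 ?addr0 => [|j ji].
  (* The term is padded with factors 1 at the other positions, so that [expect_prod] factorizes its
     expectation. *)
  transitivity (\sum_(s : {ffun 'I_n -> T}) (\prod_(k < n) Q (s k)) *
      \prod_(k < n) (if k == i then Z (s k) ^+ 2 else 1)).
    by apply: eq_bigr => s _; rewrite -big_mkcond big_pred1_eq expr2.
  rewrite (expect_prod (fun k t => if k == i then Z t ^+ 2 else 1)) (bigD1 i) //=.
  rewrite eqxx [X in _ * X]big1 ?mulr1 // => k /negbTE ->.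
  by under eq_bigr do rewrite mulr1.
transitivity (\sum_(s : {ffun 'I_n -> T}) (\prod_(k < n) Q (s k)) *
      \prod_(k < n) (if (k == i) || (k == j) then Z (s k) else 1)).
  apply: eq_bigr => s _; congr (_ * _).
  rewrite -big_mkcond (bigD1 i) ?eqxx //= (bigD1 j) ?eqxx ?orbT //= big1 ?mulr1 //.
  by move=> k /andP[/andP[/orP[]->]].
rewrite (expect_prod (fun k t => if (k == i) || (k == j) then Z t else 1)).
by rewrite (bigD1 i) //= eqxx EZ mul0r.
Qed.

(** Chebyshev's inequality: the probability is at most v / (n d^2), and [N] makes this at most
    [eps]. *)
Lemma weak_law (Z : T -> R) (d eps : R) : \sum_t Q t * Z t = 0 ->
  0 < d -> 0 < eps -> exists N : nat, forall n, (N <= n)%N ->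
  prob_iid Q (fun s : {ffun 'I_n -> T} => n%:R * d < `|\sum_(i < n) Z (s i)|) <= eps.
Proof.
move=> EZ d0 e0; set v := \sum_t Q t * Z t ^+ 2.
exists (Num.truncn (v / (d ^+ 2 * eps))).+1 => n Nn.
have n0 : 0 < n%:R :> R by rewrite ltr0n; case: n Nn.
have nd : 0 < n%:R * d by exact: mulr_gt0.
have vn : v <= n%:R * d ^+ 2 * eps.
  have /ltW : v / (d ^+ 2 * eps) < n%:R.
    by apply: lt_le_trans (truncnS_gt _) _; rewrite ler_nat.
  by rewrite ler_pdivrMr ?mulrA // mulr_gt0 // exprn_gt0.
rewrite -(ler_pM2r (exprn_gt0 2 nd)).
apply: (@le_trans _ _ (n%:R * v)); last first.
  rewrite (_ : eps * _ = n%:R * (n%:R * d ^+ 2 * eps)); last by ring.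
  by rewrite ler_wpM2l // ltW.
rewrite -variance_sum // /prob_iid mulr_suml; apply: ler_sum => s _.
rewrite -mulrA; apply: ler_wpM2l; first exact: prodr_ge0.
have [lt|_] := ltP; last by rewrite mul0r sqr_ge0.
by rewrite mul1r -(real_normK (num_real (\sum_i _))) ler_sqr ?nnegrE ?(ltW lt) ?(ltW nd).
Qed.

Lemma aep {A B : finType} (f : T -> A) (g : T -> B) (d eps : R) :
  0 < d -> 0 < eps -> exists N : nat, forall n, (N <= n)%N ->
  prob_iid Q (fun s : {ffun 'I_n -> T} =>
    ~~ (2 `^ (- (n%:R * (cent Q f g + d))) <=
        \prod_(i < n) condp Q f g (f (s i)) (g (s i)) <=
        2 `^ (- (n%:R * (cent Q f g - d))))) <= eps.
Proof.
move=> d0 e0; set H := cent Q f g.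
(* The centred log-likelihood: its mean is 0 by [centE], and its sum over a block is the logarithm
   of the product, shifted by n H ln 2. *)
pose Z t := ln (condp Q f g (f t) (g t)) + H * ln 2.
have EZ : \sum_t Q t * Z t = 0.
  under eq_bigr do rewrite mulrDr.
  by rewrite big_split /= centE // -mulr_suml Q1 mul1r addNr.
have [|N HN] := weak_law EZ _ e0 (d := d * ln 2); first by rewrite mulr_gt0 // ln2_gt0.
exists N => n /HN; apply: le_trans; apply: prob_iid_le => s Qs.
apply: contraNT; rewrite -leNgt ler_norml => /andP[lo hi].
have cs i : 0 < condp Q f g (f (s i)) (g (s i)) by apply: condp_gt0.
have -> : \prod_(i < n) condp Q f g (f (s i)) (g (s i)) =
          2 `^ ((\sum_(i < n) Z (s i)) / ln 2 - n%:R * H).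
  rewrite [X in X / ln 2]big_split /= sumr_const card_ord.
  rewrite mulrDl -mulrnAl mulfK ?gt_eqF ?ln2_gt0 // -[H *+ n]mulr_natl addrK.
  rewrite /powR gt_eqF // divfK ?gt_eqF ?ln2_gt0 // expR_sum.
  by apply: eq_bigr => i _; rewrite lnK // posrE.
have l2 := ln2_gt0 R.
apply/andP; split; apply: ler_powR; rewrite ?ler1n //.
  suff : - (n%:R * d) <= (\sum_(i < n) Z (s i)) / ln 2 by rewrite mulrDr; lra.
  by rewrite ler_pdivlMr // mulNr -mulrA.
suff : (\sum_(i < n) Z (s i)) / ln 2 <= n%:R * d by lra.
by rewrite ler_pdivrMr // -mulrA.
Qed.

End ProbIid.

(** * Counting bounds from conditional probabilities *)

Section Counting.
Context {R : realType} {T A B : finType} (Q : {ffun T -> R}).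
Variables (f : T -> A) (g : T -> B) (n : nat).
Hypothesis Qpmf : is_pmf Q.

Let Q0 t : 0 <= Q t. Proof. by case: Qpmf. Qed.
Let Q1 : \sum_t Q t = 1. Proof. by case: Qpmf. Qed.

(** Given [b], the products sum to at most 1 over all [a], and each counted [a] contributes at least
    [theta]. *)
Lemma card_condp_le (b : {ffun 'I_n -> B}) (theta : R) :
  #|[set a : {ffun 'I_n -> A} | theta <= \prod_(i < n) condp Q f g (a i) (b i)]|%:R
  * theta <= 1.
Proof.
apply: (@le_trans _ _ (\prod_(i < n) \sum_a condp Q f g a (b i))); last first.
  apply: prodr_ile1 => i _.
  by rewrite sum_condp_le1 andbT sumr_ge0 // => a _; exact: condp_ge0.
rewrite -(sum_prod_iid (fun i a => condp Q f g a (b i))) -sum1_card natr_sum mulr_suml.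
rewrite [leLHS]big_mkcond; apply: ler_sum => a _ /=; rewrite inE mul1r.
by case: ifP => // _; apply: prodr_ge0 => i _; exact: condp_ge0.
Qed.

(** For a fixed message and a fixed [b] the decoder names a single [a], which counts only if its
    conditional probability is at most [theta]. Summing over [b] gives [theta] per message. *)
Lemma prob_correct_le {I : finType} (m : {ffun 'I_n -> T} -> I)
    (dec : I -> {ffun 'I_n -> B} -> {ffun 'I_n -> A}) (theta : R) : 0 <= theta ->
  prob_iid Q (fun s => (dec (m s) [ffun i => g (s i)] == [ffun i => f (s i)]) &&
    (\prod_(i < n) condp Q f g (f (s i)) (g (s i)) <= theta)) <= #|I|%:R * theta.
Proof.
move=> theta0; rewrite /prob_iid.
set ok := fun j (s : {ffun 'I_n -> T}) =>
  (dec j [ffun i => g (s i)] == [ffun i => f (s i)]) &&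
  (\prod_(i < n) condp Q f g (f (s i)) (g (s i)) <= theta).
have pQ (s : {ffun 'I_n -> T}) : 0 <= \prod_(i < n) Q (s i) by exact: prodr_ge0.
(* The actual message [m s] is replaced by all messages [j], which removes the dependence on the
   encoder. *)
apply: (@le_trans _ _ (\sum_j \sum_(s : {ffun 'I_n -> T}) (\prod_(i < n) Q (s i)) * (ok j s)%:R)).
  rewrite exchange_big /=; apply: ler_sum => s _.
  by rewrite (bigD1 (m s)) //= lerDl sumr_ge0 // => j _; rewrite mulr_ge0.
rewrite mulr_natl -sumr_const; apply: ler_sum => j _.
rewrite (partition_big (fun s : {ffun 'I_n -> T} => [ffun i => g (s i)]) predT) //=.
have <- : theta * \sum_(b : {ffun 'I_n -> B}) \prod_(i < n) marg Q g (b i) = theta.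
  rewrite (sum_prod_iid (fun _ b => marg Q g b)) big1 ?mulr1 // => i _.
  by rewrite -Q1 (partition_big g predT).
rewrite mulr_sumr; apply: ler_sum => b _.
have [le|gt] := leP (\prod_(i < n) condp Q f g (dec j b i) (b i)) theta; last first.
  rewrite big1 => [|s /eqP sb].
    by rewrite mulr_ge0 // prodr_ge0 // => i _; exact: marg_ge0.
  rewrite /ok sb; case: eqP => [ab|]; last by rewrite mulr0.
  suff -> : \prod_(i < n) condp Q f g (f (s i)) (g (s i)) <= theta = false by rewrite mulr0.
  apply/negbTE; rewrite -ltNge (eq_bigr (fun i => condp Q f g (dec j b i) (b i))) // => i _.
  by rewrite ab -sb !ffunE.
apply: (@le_trans _ _ (\sum_(s : {ffun 'I_n -> T} |
    [forall i, (f (s i), g (s i)) == ([ffun i => (dec j b i, b i)] i)]) \prod_(i < n) Q (s i))).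
  rewrite big_mkcond [leRHS]big_mkcond; apply: ler_sum => s _ /=.
  case: ifP => [/eqP sb|_]; last by case: ifP.
  have [oks|_] := boolP (ok j s); last by rewrite mulr0; case: ifP.
  rewrite mulr1 ifT //; apply/forallP => i.
  by move: oks; rewrite /ok sb => /andP[/eqP -> _]; rewrite -sb !ffunE.
rewrite (sum_iid_marg Q (fun t => (f t, g t))).
under eq_bigr do rewrite ffunE marg_pairE //.
rewrite big_split /=; apply: ler_wpM2r => //.
by apply: prodr_ge0 => i _; exact: marg_ge0.
Qed.

End Counting.

(** * Greedy edge colouring of a bipartite graph *)

Lemma leq_card_heavy (T I : finType) (S : {set T}) (c : T -> I) (D M : nat) :
  (#|S| < D)%N -> (2 * D <= #|I| * M)%N ->
  (2 * #|[set j | (M <= #|[set x in S | c x == j]|)%N]| < #|I|)%N.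
Proof.
move=> SD DM; set H := [set j | _].
(* The fibres over heavy labels are disjoint with at least [M] elements each; if half of the labels
   were heavy, [D <= #|S|] would follow. *)
have HS : (#|H| * M <= #|S|)%N.
  rewrite -sum_nat_const -[X in (_ <= X)%N]sum1_card (partition_big c predT) //=.
  rewrite [X in (_ <= X)%N](bigID [in H]) /=; apply: leq_trans (leq_addr _ _).
  apply: leq_sum => j; rewrite inE => /leq_trans; apply.
  by rewrite -sum1_card; under eq_bigl do rewrite inE.
rewrite ltnNge; apply/negP => IH.
have : (#|I| * M <= 2 * #|H| * M)%N by rewrite leq_mul2r IH orbT.
by rewrite -mulnA => /(leq_trans DM); rewrite leq_mul2l /= => /leq_trans/(_ HS); rewrite leqNgt SD.
Qed.

Lemma exists_notin (T : finType) (S : {set T}) : (#|S| < #|T|)%N -> exists x, x \notin S.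
Proof.
rewrite -(cardsC S) -[X in (X < _)%N]addn0 ltn_add2l card_gt0 => /set0Pn[x].
by rewrite inE; exists x.
Qed.

(* Greedy choice: a label j in 'I_m0 is forbidden at a vertex once m1 (resp. m2)
   edges there carry it.  By the degree bounds, either endpoint of a new edge
   forbids fewer than half of the labels. *)
Lemma edge_coloring (A B : finType) (E : {set A * B}) (d1 d2 m0 m1 m2 : nat) :
  (forall b, (#|[set e in E | e.2 == b]| <= d1)%N) ->
  (forall a, (#|[set e in E | e.1 == a]| <= d2)%N) ->
  (0 < m0)%N -> (0 < m1)%N -> (0 < m2)%N ->
  (2 * d1 <= m0 * m1)%N -> (2 * d2 <= m0 * m2)%N ->
  exists c : A * B -> 'I_m0 * 'I_m1 * 'I_m2,
    forall e e', e \in E -> e' \in E -> e != e' ->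
      (e.2 = e'.2 -> (c e).1 != (c e').1) /\
      (e.1 = e'.1 -> ((c e).1.1, (c e).2) != ((c e').1.1, (c e').2)).
Proof.
move=> dB dA p0 p1 p2 D1 D2.
suff H k (S : {set A * B}) : #|S| = k -> S \subset E ->
    exists c : A * B -> 'I_m0 * 'I_m1 * 'I_m2,
    forall e e', e \in S -> e' \in S -> e != e' ->
      (e.2 = e'.2 -> (c e).1 != (c e').1) /\
      (e.1 = e'.1 -> ((c e).1.1, (c e).2) != ((c e').1.1, (c e').2)).
  exact: (H _ E erefl).
elim: k S => [|k IH] S cS SE.
  exists (fun _ => (Ordinal p0, Ordinal p1, Ordinal p2)) => e e'.
  by move/eqP: cS; rewrite cards_eq0 => /eqP->; rewrite inE.
have /set0Pn[e eS] : S != finset.set0 by rewrite -card_gt0 cS.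
(* All edges of [S] but [e] are coloured by induction; [e] is coloured last. *)
have [|c Hc] := IH (S :\ e) _ (fintype.subset_trans (finset.subsetDl _ _) SE).
  by move: cS; rewrite (cardsD1 e) eS => -[].
pose SB := [set x in S :\ e | x.2 == e.2].
pose SA := [set x in S :\ e | x.1 == e.1].
have eE : e \in E by exact: (fintype.subsetP SE).
have SE' x : x \in S :\ e -> x \in E.
  by rewrite in_setD1 => /andP[_]; exact: (fintype.subsetP SE).
(* Strict, because [e] itself counts towards the degree in [E] but is not in [SB]. *)
have ltB : (#|SB| < d1)%N.
  apply: leq_trans (dB e.2); apply/proper_card/properP; split.
    by apply/fintype.subsetP => x; rewrite !inE -in_setD1 => /andP[/SE' -> ->].
  by exists e; rewrite !inE !eqxx ?eE.
have ltA : (#|SA| < d2)%N.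
  apply: leq_trans (dA e.1); apply/proper_card/properP; split.
    by apply/fintype.subsetP => x; rewrite !inE -in_setD1 => /andP[/SE' -> ->].
  by exists e; rewrite !inE !eqxx ?eE.
have h1 := @leq_card_heavy _ 'I_m0 SB (fun x => (c x).1.1) d1 m1 ltB.
have h2 := @leq_card_heavy _ 'I_m0 SA (fun x => (c x).1.1) d2 m2 ltA.
rewrite !card_ord in h1 h2; move: {h1 h2} (h1 D1) (h2 D2).
set bad1 := [set j | _]; set bad2 := [set j | _] => h1 h2.
(* Each bad set has fewer than half of the labels, so some [j] is bad at neither endpoint. Fewer
   than [m1] edges of [SB] and fewer than [m2] edges of [SA] carry [j], which leaves free values
   [k1] and [k2]. *)
have [|j] := @exists_notin _ (bad1 :|: bad2).
  rewrite card_ord; apply: leq_ltn_trans (leq_card_setU _ _) _.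
  by rewrite -(@ltn_pmul2l 2) // mulnDr [X in (_ < X)%N]mul2n -addnn; exact: leq_add h1 (ltnW h2).
rewrite inE negb_or !inE -!ltnNge => /andP[j1 j2].
have [|k1 k1P] := @exists_notin _ [set (c x).1.2 | x in SB & (c x).1.1 == j].
  rewrite card_ord; apply: leq_ltn_trans (leq_imset_card _ _) _.
  by apply: leq_ltn_trans j1; apply/subset_leq_card/fintype.subsetP => x; rewrite !inE.
have [|k2 k2P] := @exists_notin _ [set (c x).2 | x in SA & (c x).1.1 == j].
  rewrite card_ord; apply: leq_ltn_trans (leq_imset_card _ _) _.
  by apply: leq_ltn_trans j2; apply/subset_leq_card/fintype.subsetP => x; rewrite !inE.
pose c' x := if x == e then (j, k1, k2) else c x.
have new x : x \in S -> x != e ->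
    (x.2 = e.2 -> (j, k1) != (c x).1) /\ (x.1 = e.1 -> (j, k2) != ((c x).1.1, (c x).2)).
  move=> xS xe; split=> xeq.
    apply: contraNneq k1P => jk; apply/imsetP; exists x; last by rewrite -jk.
    by rewrite !inE xS xe xeq -jk !eqxx.
  apply: contraNneq k2P => -[jk ->]; apply/imsetP; exists x => //.
  by rewrite !inE xS xe xeq -jk !eqxx.
exists c' => x y xS yS xy; rewrite /c'; case: (eqVneq x e) => [xe|xe].
  have ye : y != e by rewrite -xe eq_sym.
  by have [n1 n2] := new y yS ye; rewrite (negbTE ye) xe; split=> /esym.
case: (eqVneq y e) => [ye|ye]; last by apply: Hc; rewrite ?in_setD1 ?xe ?ye.
have [n1 n2] := new x xS xe; rewrite ye.
by split=> ?; rewrite eq_sym; [exact: n1|exact: n2].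
Qed.

(** * Powers of two, rates, and the bounds for a single decoder *)

Lemma powR2_gt0 (R : realType) (x : R) : 0 < 2 `^ x.
Proof. by rewrite powR_gt0. Qed.

Lemma powR2D (R : realType) (x y : R) : 2 `^ (x + y) = 2 `^ x * 2 `^ y.
Proof. by rewrite powRD // pnatr_eq0 implybT. Qed.

Lemma powR2N_le1 (R : realType) (x y : R) : (y * 2 `^ (- x) <= 1) = (y <= 2 `^ x).
Proof. by rewrite powRN ler_pdivrMr ?powR2_gt0 // mul1r. Qed.

Lemma rate_le (R : realType) (n m : nat) (r : R) : (0 < n)%N -> (0 < m)%N ->
  (rate n m <= r) = (m%:R <= 2 `^ (n%:R * r)).
Proof.
move=> n0 m0; rewrite /rate ler_pdivrMl ?ltr0n // /log2 ler_pdivrMr ?ln2_gt0 //.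
by rewrite -ln_powR ler_ln // posrE ?ltr0n // powR2_gt0.
Qed.

Lemma rate_ge0 (R : realType) (n m : nat) : (0 < m)%N -> 0 <= rate n m :> R.
Proof.
by move=> m0; rewrite /rate /log2 !mulr_ge0 // ?invr_ge0 ?ln_ge0 ?ler1n.
Qed.

Lemma truncn_half (R : realType) (z : R) : 1 <= z -> z / 2 <= (Num.truncn z)%:R <= z.
Proof.
move=> z1; have /andP[le lt] := truncn_itv (le_trans ler01 z1); rewrite le andbT.
have : 1 <= (Num.truncn z)%:R :> R by rewrite ler1n truncn_gt0.
by move: lt; rewrite -addn1 natrD; lra.
Qed.

(** The converse for one decoder with side information [g]. If [rho] were below the conditional
    entropy, then for large [n] error, atypicality and correct decoding of a typical block would
    have total probability below 1, although they cover all blocks. *)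
Lemma cent_le_rate (R : realType) (T A B : finType) (Q : {ffun T -> R})
    (f : T -> A) (g : T -> B) (rho : R) : is_pmf Q ->
  (forall eps : R, 0 < eps -> exists N : nat, forall n : nat, (N <= n)%N ->
    exists (I : finType) (m : {ffun 'I_n -> T} -> I)
           (dec : I -> {ffun 'I_n -> B} -> {ffun 'I_n -> A}),
      prob_iid Q (fun s => dec (m s) [ffun i => g (s i)] != [ffun i => f (s i)]) <= eps /\
      #|I|%:R <= 2 `^ (n%:R * (rho + eps))) ->
  cent Q f g <= rho.
Proof.
move=> Qpmf code; rewrite leNgt; apply/negP; set H := cent Q f g => rhoH.
(* The first bound gives (rho + e) - (H - e) <= -2e, so once n e >= 1 correct decoding of a typical
   block has probability at most 2^(-2). The second keeps the total e + 1/4 + 1/4 below 1. *)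
pose e := Num.min ((H - rho) / 4) (1 / 4).
have e0 : 0 < e by rewrite lt_min; apply/andP; split; lra.
have e1 : e <= (H - rho) / 4 by rewrite ge_min lexx.
have e2 : e <= 1 / 4 by rewrite ge_min lexx orbT.
have [N1 HN1] := code e e0.
have [|N2 HN2] := aep Qpmf f g (d := e) (eps := 1 / 4) e0; first lra.
pose n := maxn (maxn N1 N2) (Num.truncn e^-1).+1.
have [|I [m [dec [err cI]]]] := HN1 n; first by rewrite !leq_max leqnn.
have [|] := boolP (N2 <= n)%N => [/HN2 atyp|]; last by rewrite !leq_max leqnn orbT.
have ne : 1 <= n%:R * e.
  rewrite -ler_pdivrMr // mul1r; apply: ltW; apply: lt_le_trans (truncnS_gt _) _.
  by rewrite ler_nat leq_max leqnn orbT.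
pose theta : R := 2 `^ (- (n%:R * (H - e))).
have theta0 : 0 <= theta by exact: powR_ge0.
have ok := prob_correct_le f g Qpmf m dec theta0.
have : #|I|%:R * theta <= 4^-1.
  apply: (@le_trans _ _ (2 `^ (n%:R * (rho + e)) * theta)); first by rewrite ler_wpM2r.
  rewrite -powR2D (_ : 4^-1 = 2 `^ (- 2%:R)); last first.
    by rewrite powRN powR_mulrn // expr2 -natrM.
  apply: ler_powR; rewrite ?ler1n //.
  have : n%:R * (4 * e) <= n%:R * (H - rho) by rewrite ler_wpM2l //; lra.
  by nra.
suff : 1 <= e + 1 / 4 + #|I|%:R * theta by lra.
rewrite -[X in X <= _](prob_iidT Qpmf n) -addrA.
apply: le_trans (lerD err (lerD atyp ok)).
apply: le_trans (lerD (lexx _) (prob_iidU Qpmf _ _)).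
apply: le_trans (prob_iidU Qpmf _ _).
apply: prob_iid_le => // s _ _.
by rewrite -/H -/theta; case: eqP => //= _; rewrite negb_and -orbA orNb orbT.
Qed.

(** This bounds the degree of the vertex [b] in a graph with edge set [E]: on the fibre over [b],
    [p] is injective into the set counted by [card_condp_le]. Stating it for abstract [p] and [q]
    serves both sides of the bipartite graph. *)
Lemma card_fiber_le (R : realType) (T A B C : finType) (Q : {ffun T -> R})
    (f : T -> A) (g : T -> B) (n : nat) (z : R) (E : {set C})
    (p : C -> {ffun 'I_n -> A}) (q : C -> {ffun 'I_n -> B}) b :
  is_pmf Q -> (forall c c', p c = p c' -> q c = q c' -> c = c') ->
  (forall c, c \in E -> 2 `^ (- z) <= \prod_(i < n) condp Q f g (p c i) (q c i)) ->
  (#|[set c in E | q c == b]| <= Num.truncn (2 `^ z : R))%N.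
Proof.
move=> Qpmf pq HE; rewrite truncn_ge_nat ?powR_ge0 // -powR2N_le1.
apply: le_trans (card_condp_le f g Qpmf b (2 `^ (- z))); rewrite ler_wpM2r ?powR_ge0 // ler_nat.
rewrite -(card_in_imset (f := p)) => [|c c'].
  apply/subset_leq_card/fintype.subsetP => a /imsetP[c].
  by rewrite !inE => /andP[cE /eqP <-] ->; exact: HE.
by rewrite !inE => /andP[_ /eqP qc] /andP[_ /eqP qc'] pc; apply: pq => //; rewrite qc qc'.
Qed.

(** * The coding problem with U = Y and V = X: converse and achievability *)

Section SideInformation.
Context {R : realType} {X Y : finType} (Q : {ffun X * Y * Y * X -> R}).
Hypothesis Qpmf : is_pmf Q.
Hypothesis Qdiag : forall (x : X) (y : Y) (u : Y) (v : X), Q (x, y, u, v) != 0 -> u = y /\ v = x.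

Let fX (t : X * Y * Y * X) := t.1.1.1.
Let fY (t : X * Y * Y * X) := t.1.1.2.
Let fU (t : X * Y * Y * X) := t.1.2.
Let fV (t : X * Y * Y * X) := t.2.
Let HX := cent Q fX fU.
Let HY := cent Q fY fV.

Let support_diag t : Q t != 0 -> fU t = fY t /\ fV t = fX t.
Proof. by case: t => [[[x y] u] v] /Qdiag. Qed.

(** The letters obtained here serve as default decoder outputs and as inputs to an encoder, whose
    value shows that the index sets are nonempty. *)
Lemma pmf_support : exists t, Q t != 0.
Proof.
have [t|Q0] := pickP (fun t => Q t != 0); first by exists t.
have [_] := Qpmf; rewrite big1 => [/eqP|t _]; first by rewrite eq_sym oner_eq0.
by apply/eqP/negbFE/Q0.
Qed.

Definition region : set (R * R * R) :=
  [set r | [/\ [/\ 0 <= r.1.1, 0 <= r.1.2 & 0 <= r.2],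
               HX <= r.1.1 + r.1.2 & HY <= r.1.1 + r.2]]%classic.

Lemma achievable_le_region r : achievable Q r -> region r.
Proof.
move=> ach; have [[[[x y] u] v] _] := pmf_support.
have sizes n m0 m1 m2 (e : {ffun 'I_n -> X} -> {ffun 'I_n -> Y} -> 'I_m0 * 'I_m1 * 'I_m2) :
    [/\ (0 < m0)%N, (0 < m1)%N & (0 < m2)%N].
  case: (e [ffun=> x] [ffun=> y]) => [[[i0 +] [i1 +]] [i2 +]].
  by split; apply: leq_ltn_trans (leq0n _) _; eassumption.
have ge0 (r0 : R) : (forall eps, 0 < eps -> 0 <= r0 + eps) -> 0 <= r0.
  move=> h; rewrite leNgt; apply/negP => r0lt.
  by have := h (- r0 / 2); lra.
have sum_rate n m m' a b eps : (0 < n)%N -> (0 < m)%N -> (0 < m')%N ->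
    rate n m <= a + eps / 2 :> R -> rate n m' <= b + eps / 2 ->
    (m * m')%:R <= 2 `^ (n%:R * (a + b + eps)).
  move=> n0 mp mp'; rewrite !rate_le // => ra rb.
  rewrite natrM (_ : n%:R * _ = n%:R * (a + eps / 2) + n%:R * (b + eps / 2)); last by field.
  by rewrite powR2D ler_pM.
have half eps : 0 < eps -> 0 < eps / 2 :> R by move=> ?; lra.
split; [split|..].
- apply: ge0 => eps /ach[N /(_ _ (leqnn N))[m0 [m1 [m2 [e [_ [_ [_ H _ _]]]]]]]].
  by have [p _ _] := sizes _ _ _ _ e; exact: le_trans (rate_ge0 _ _ p) H.
- apply: ge0 => eps /ach[N /(_ _ (leqnn N))[m0 [m1 [m2 [e [_ [_ [_ _ H _]]]]]]]].
  by have [_ p _] := sizes _ _ _ _ e; exact: le_trans (rate_ge0 _ _ p) H.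
- apply: ge0 => eps /ach[N /(_ _ (leqnn N))[m0 [m1 [m2 [e [_ [_ [_ _ _ H]]]]]]]].
  by have [_ _ p] := sizes _ _ _ _ e; exact: le_trans (rate_ge0 _ _ p) H.
- apply: cent_le_rate => // eps e0; have [N HN] := ach _ (half _ e0).
  exists (maxn N 1) => n; rewrite geq_max => /andP[/HN + n0] => -[m0 [m1 [m2 [e [dx [dy]]]]]] /=.
  rewrite ge_max => -[/andP[err _] r0 r1 _]; have [p0 p1 p2] := sizes _ _ _ _ e.
  (* The two indices seen by the decoder form one message, whose rate slack is twice eps/2. *)
  exists ('I_m0 * 'I_m1)%type, (fun s => (e (seqX s) (seqY s)).1), (fun c => dx c.1 c.2).
  split; last by rewrite card_prod !card_ord sum_rate.
  by apply: le_trans err _; lra.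
- apply: cent_le_rate => // eps e0; have [N HN] := ach _ (half _ e0).
  exists (maxn N 1) => n; rewrite geq_max => /andP[/HN + n0] => -[m0 [m1 [m2 [e [dx [dy]]]]]] /=.
  rewrite ge_max => -[/andP[_ err] r0 _ r2]; have [p0 p1 p2] := sizes _ _ _ _ e.
  exists ('I_m0 * 'I_m2)%type,
    (fun s => let c := e (seqX s) (seqY s) in (c.1.1, c.2)), (fun c => dy c.1 c.2).
  split; last by rewrite card_prod !card_ord sum_rate.
  by apply: le_trans err _; lra.
Qed.

Lemma region_achievable r : region r -> achievable Q r.
Proof.
move=> [[r00 r10 r20] rX rY] eps e0; have [[[[x0 y0] _] _] _] := pmf_support.
have h0 : 0 < eps / 2 by lra.
have [N1 HN1] := aep Qpmf fX fU e0 h0.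
have [N2 HN2] := aep Qpmf fY fV e0 h0.
(* The bound n eps >= 3 pays for a factor 8: one factor 2 from the colouring lemma and one from each
   of the two truncated index set sizes. *)
exists (maxn (maxn N1 N2) (Num.truncn (3 / eps)).+1) => n.
rewrite !geq_max => /andP[/andP[/HN1 {HN1} atX /HN2 {HN2} atY] nN].
have n0 : (0 < n)%N by case: n nN {atX atY}.
have ne : 3 <= n%:R * eps.
  rewrite -ler_pdivrMr //; apply: ltW; apply: lt_le_trans (truncnS_gt _) _.
  by rewrite ler_nat.
pose w (a : R) : R := 2 `^ (n%:R * (a + eps)).
pose M a := Num.truncn (w a).
have wM a : 0 <= a -> w a / 2 <= (M a)%:R <= w a.
  move=> a0; apply: truncn_half; rewrite -[X in X <= _](powRr0 2).
  by apply: ler_powR; rewrite ?ler1n // mulr_ge0 // addr_ge0 // ltW.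
have M0 a : 0 <= a -> (0 < M a)%N.
  move=> /wM /andP[+ _]; rewrite -(ltr0n R); apply: lt_le_trans.
  by rewrite divr_gt0 // powR2_gt0.
have Mrate a : 0 <= a -> rate n (M a) <= a + eps.
  by move=> a0; rewrite rate_le ?M0 //; have /andP[] := wM a a0.
have M2 a b H : 0 <= a -> 0 <= b -> H <= a + b ->
    (2 * Num.truncn (2 `^ (n%:R * (H + eps)) : R) <= M a * M b)%N.
  move=> a0 b0 Hab; rewrite -(ler_nat R) !natrM.
  have /andP[wa _] := wM a a0; have /andP[wb _] := wM b b0.
  apply: (@le_trans _ _ (w a / 2 * (w b / 2))); last first.
    by rewrite ler_pM // divr_ge0 // powR_ge0.
  apply: (@le_trans _ _ (2 * w H)); first by rewrite ler_wpM2l // truncn_le powR_ge0.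
  suff : 2 `^ 3%:R * w H <= w a * w b by rewrite powR_mulrn // !exprS expr0; lra.
  rewrite /w -!powR2D; apply: ler_powR; rewrite ?ler1n //.
  have : n%:R * H <= n%:R * (a + b) by rewrite ler_wpM2l.
  by move: ne; rewrite !mulrDr; lra.
pose TX (a : {ffun 'I_n -> X}) (b : {ffun 'I_n -> Y}) :=
  2 `^ (- (n%:R * (HX + eps))) <= \prod_(i < n) condp Q fX fU (a i) (b i).
pose TY (a : {ffun 'I_n -> X}) (b : {ffun 'I_n -> Y}) :=
  2 `^ (- (n%:R * (HY + eps))) <= \prod_(i < n) condp Q fY fV (b i) (a i).
(* Only the lower typicality bounds are imposed; they suffice to bound the degrees. Here [b] stands
   for the side information U^n and [a] for V^n. *)
pose E := [set e : {ffun 'I_n -> X} * {ffun 'I_n -> Y} | TX e.1 e.2 && TY e.1 e.2].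
have degB b : (#|[set e in E | e.2 == b]| <= Num.truncn (2 `^ (n%:R * (HX + eps)) : R))%N.
  apply: (@card_fiber_le R _ _ _ _ Q fX fU n _ E fst snd b) => //.
    by move=> [? ?] [? ?] /= -> ->.
  by move=> e; rewrite inE => /andP[].
have degA a : (#|[set e in E | e.1 == a]| <= Num.truncn (2 `^ (n%:R * (HY + eps)) : R))%N.
  apply: (@card_fiber_le R _ _ _ _ Q fY fV n _ E snd fst a) => //.
    by move=> [? ?] [? ?] /= -> ->.
  by move=> e; rewrite inE => /andP[].
have [c Hc] := edge_coloring degB degA (M0 _ r00) (M0 _ r10) (M0 _ r20)
  (M2 _ _ _ r00 r10 rX) (M2 _ _ _ r00 r20 rY).
exists (M r.1.1), (M r.1.2), (M r.2), (fun a b => c (a, b)).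
(* Each decoder looks among the edges at its own vertex for one with the received labels; the
   colouring makes it unique. The default is output only if there is none. *)
exists (fun m0 m1 b => odflt [ffun=> x0] [pick a | ((a, b) \in E) && ((c (a, b)).1 == (m0, m1))]).
exists (fun m0 m2 a => odflt [ffun=> y0]
  [pick b | ((a, b) \in E) && (((c (a, b)).1.1, (c (a, b)).2) == (m0, m2))]).
have dX a b : (a, b) \in E -> odflt [ffun=> x0]
    [pick a' | ((a', b) \in E) && ((c (a', b)).1 == ((c (a, b)).1.1, (c (a, b)).1.2))] = a.
  move=> abE; rewrite -surjective_pairing; case: pickP => [a' /= /andP[E' ca]|/(_ a)]; last first.
    by rewrite abE eqxx.
  apply: contraTeq ca => aa'; have ne' : (a', b) != (a, b) by apply: contraNneq aa' => -[->].
  by have [/(_ erefl)] := Hc _ _ E' abE ne'.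
have dY a b : (a, b) \in E -> odflt [ffun=> y0] [pick b' | ((a, b') \in E) &&
    (((c (a, b')).1.1, (c (a, b')).2) == ((c (a, b)).1.1, (c (a, b)).2))] = b.
  move=> abE; case: pickP => [b' /= /andP[E' ca]|/(_ b)]; last by rewrite abE eqxx.
  apply: contraTeq ca => bb'; have ne' : (a, b') != (a, b) by apply: contraNneq bb' => -[->].
  by have [_ /(_ erefl)] := Hc _ _ E' abE ne'.
(* An error forces the pair out of [E], so one of the two typicality bounds fails, each with
   probability at most eps/2. *)
have errE (F : {ffun 'I_n -> X * Y * Y * X} -> bool) :
    (forall s : {ffun 'I_n -> X * Y * Y * X}, (forall i, Q (s i) != 0) -> (seqX s, seqY s) \in E -> ~~ F s) ->
    prob_iid Q F <= eps.
  move=> EF; rewrite [eps]splitr; apply: le_trans (lerD atX atY).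
  apply: le_trans (prob_iidU Qpmf _ _); apply: prob_iid_le => // s Qs.
  apply: contraTT; rewrite negb_or !negbK => /andP[/andP[tX _] /andP[tY _]].
  apply: EF => //; rewrite inE; apply/andP; split.
    by apply: le_trans tX _; rewrite le_eqVlt; apply/orP; left; apply/eqP/eq_bigr => i _;
       rewrite !ffunE (proj1 (support_diag (Qs i))).
  by apply: le_trans tY _; rewrite le_eqVlt; apply/orP; left; apply/eqP/eq_bigr => i _;
     rewrite !ffunE (proj2 (support_diag (Qs i))).
have UY (s : {ffun 'I_n -> X * Y * Y * X}) : (forall i, Q (s i) != 0) -> seqU s = seqY s.
  by move=> Qs; apply/ffunP => i; rewrite !ffunE; case: (support_diag (Qs i)).
have VX (s : {ffun 'I_n -> X * Y * Y * X}) : (forall i, Q (s i) != 0) -> seqV s = seqX s.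
  by move=> Qs; apply/ffunP => i; rewrite !ffunE; case: (support_diag (Qs i)).
split; [rewrite ge_max; apply/andP; split|exact: Mrate..].
  by apply: errE => s Qs sE; rewrite negbK UY // dX.
by apply: errE => s Qs sE; rewrite negbK VX // dY.
Qed.

Lemma closed_region : closed region.
Proof.
have c0 : continuous (fun r : R * R * R => r.1.1).
  by move=> r; apply: (@cvg_comp _ _ _ fst fst); exact: cvg_fst.
have c1 : continuous (fun r : R * R * R => r.1.2).
  by move=> r; apply: (@cvg_comp _ _ _ fst snd); [exact: cvg_fst|exact: cvg_snd].
have c2 : continuous (fun r : R * R * R => r.2) by move=> r; exact: cvg_snd.
have ge (h : R * R * R -> R) (a : R) : continuous h -> closed [set r | a <= h r]%classic.
  by move=> hc; apply: (@preimage_closed _ _ h [set x | a <= x]%classic (fun x _ => hc x)); exact: closed_ge.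
have -> : region =
    ([set r | 0 <= r.1.1] `&` [set r | 0 <= r.1.2] `&` [set r | 0 <= r.2] `&`
     ([set r | HX <= r.1.1 + r.1.2] `&` [set r | HY <= r.1.1 + r.2]))%classic.
  apply/seteqP; split=> r; first by case=> [[? ? ?] ? ?].
  by case=> [[[? ?] ?] [? ?]].
by do ![apply: closedI]; apply: ge => // r; apply: cvgD; [exact: c0|exact: c1|exact: c0|exact: c2].
Qed.

(** * Comparison of the outer regions with the explicit region *)

Section Kernel.
Context {W : finType} (k : {ffun X * Y -> {ffun W -> R}}).
Hypothesis kpmf : is_kernel k.
Let p := joint Q k.

Lemma joint_support t : p t != 0 ->
  [/\ rvU t = rvY t, rvV t = rvX t & k (rvX t, rvY t) (rvW t) != 0].
Proof.
case: t => [[[[w x] y] u] v]; rewrite /p /joint mulf_eq0 negb_or => /andP[kw].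
by case/Qdiag.
Qed.

Lemma marg_joint q : marg p (fun t => (rvX t, rvY t, rvU t, rvV t)) q = Q q.
Proof.
case: q => [[[x y] u] v]; rewrite /marg.
rewrite (reindex_onto (fun w => (w, x, y, u, v)) rvW) /=; last first.
  by case=> [[[[w x'] y'] u'] v'] /eqP[/= <- <- <- <-].
rewrite (eq_bigl predT) => [|w]; last by rewrite !eqxx.
by rewrite -mulr_suml; case: (kpmf (x, y)) => _ ->; rewrite mul1r.
Qed.

Lemma cent_joint {A B : finType} (f : X * Y * Y * X -> A) (g : X * Y * Y * X -> B) :
  let q t := (rvX t, rvY t, rvU t, rvV t) in
  cent p (f \o q) (g \o q) = cent Q f g.
Proof.
by rewrite /cent -(ent_comp g marg_joint) -(ent_comp (fun q => (f q, g q)) marg_joint).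
Qed.

(** As U determines Y on the support, H(X,Y|U) = H(X|U) and H(X,Y|W,U) = H(X|W,U); the latter
    cancels. *)
Lemma cmi_cent_X : cmi p rvXY rvW rvU + cent p rvX rvWU = HX.
Proof.
rewrite -[HX](cent_joint fX fU) /cmi /cent.
have -> : ent p (fun t => (rvXY t, rvU t)) = ent p (fun t => (rvX t, rvU t)).
  apply: eq_ent => t t' /joint_support[tY _ _] /joint_support[tY' _ _].
  by rewrite /rvXY !xpair_eqE tY tY' -andbA andbb.
have -> : ent p (fun t => (rvXY t, (rvW t, rvU t))) = ent p (fun t => (rvX t, rvWU t)).
  apply: eq_ent => t t' /joint_support[tY _ _] /joint_support[tY' _ _].
  rewrite /rvXY /rvWU !xpair_eqE tY tY' -andbA; congr (_ && _).
  by rewrite andbCA andbb.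
by rewrite /comp /fX /fU /rvWU /=; ring.
Qed.

Lemma cmi_cent_Y : cmi p rvXY rvW rvV + cent p rvY rvWV = HY.
Proof.
rewrite -[HY](cent_joint fY fV) /cmi /cent.
have -> : ent p (fun t => (rvXY t, rvV t)) = ent p (fun t => (rvY t, rvV t)).
  apply: eq_ent => t t' /joint_support[_ tX _] /joint_support[_ tX' _].
  by rewrite /rvXY !xpair_eqE tX tX' andbAC andbb andbC.
have -> : ent p (fun t => (rvXY t, (rvW t, rvV t))) = ent p (fun t => (rvY t, rvWV t)).
  apply: eq_ent => t t' /joint_support[_ tX _] /joint_support[_ tX' _].
  rewrite /rvXY /rvWV !xpair_eqE tX tX'.
  by case: (rvX t == rvX t'); rewrite ?andbF.
by rewrite /comp /fY /fV /rvWV /=; ring.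
Qed.

(** J dominates each of the two mutual informations, so the sum constraints imply those with H(X|U)
    and H(Y|V). *)
Lemma Rout_sub_region : (Rout Q k `<=` region)%classic.
Proof.
move=> r [r0 _ rX rY]; split=> //.
  by apply: le_trans rX; rewrite -cmi_cent_X lerD2r le_max lexx.
by apply: le_trans rY; rewrite -cmi_cent_Y lerD2r le_max lexx orbT.
Qed.

Lemma cmi_const (S : finType) (h : W * X * Y * Y * X -> S) (w0 : W) :
  (forall xy w, k xy w != 0 -> w = w0) -> cmi p rvXY rvW h = 0.
Proof.
move=> kw; have pw t : p t != 0 -> rvW t = w0 by case/joint_support => _ _ /kw.
rewrite /cmi /cent.
rewrite (@eq_ent _ _ _ _ p (fun t => (rvXY t, (rvW t, h t))) (fun t => (rvXY t, h t))).
  rewrite (@eq_ent _ _ _ _ p (fun t => (rvW t, h t)) h) ?subrr // => t t' /pw tw /pw tw'.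
  by rewrite xpair_eqE tw tw' eqxx.
by move=> t t' /pw tw /pw tw'; rewrite !xpair_eqE tw tw' eqxx.
Qed.

(** A constant W gives J = 0, and the two chain-rule identities then turn the sum constraints into
    those of [region]. *)
Lemma region_sub_Rout (w0 : W) :
  (forall xy w, k xy w != 0 -> w = w0) -> (region `<=` Rout Q k)%classic.
Proof.
move=> kw r [r0 rX rY]; have := cmi_cent_X; have := cmi_cent_Y.
rewrite /Rout /= -/p !(cmi_const _ kw) maxxx !add0r => -> ->.
by split => //; case: r0.
Qed.

End Kernel.

End SideInformation.

(** * Equality of the achievable region and the closure *)

Local Open Scope classical_set_scope.

Theorem theorem6 (R : realType) (X Y W : finType)
  (Q : {ffun X * Y * Y * X -> R}) :
  is_pmf Q ->
  (forall (x : X) (y : Y) (u : Y) (v : X), Q (x, y, u, v) != 0 -> u = y /\ v = x) ->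
  (0 < #|W|)%N -> (#|W| <= #|X| * #|Y| + 3)%N ->
  achievable_region Q =
  closure (\bigcup_(k in [set k : {ffun X * Y -> {ffun W -> R}} | is_kernel k])
             Rout Q k).
Proof.
move=> Qpmf Qdiag /card_gt0P[w0 _] _.
have -> : achievable_region Q = @region R X Y Q.
  apply/seteqP; split=> r; first exact: achievable_le_region.
  exact: region_achievable.
apply/seteqP; split.
  (* The point mass at [w0] for every pair of letters: a single kernel already yields the whole
     region. *)
  pose k0 : {ffun X * Y -> {ffun W -> R}} := [ffun=> [ffun w => (w == w0)%:R]].
  have k0pmf : is_kernel k0.
    move=> xy; split=> [w|]; first by rewrite !ffunE ler0n.
    under eq_bigr do rewrite !ffunE.
    by rewrite (bigD1 w0) //= eqxx big1 ?addr0 // => w /negbTE ->.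
  apply: subset_trans (@subset_closure _ _) => r rin; exists k0 => //.
  apply: (region_sub_Rout Qdiag k0pmf (w0 := w0)) rin => xy w.
  by rewrite !ffunE pnatr_eq0 eqb0 negbK => /eqP.
(* The region is its own closure, so it is enough to include each [Rout Q k] in it. *)
rewrite [X in _ `<=` X](proj1 (closure_id _) (@closed_region R X Y Q)).
by apply: closureS => r [k kpmf]; exact: Rout_sub_region.
Qed.
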